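(* Let $\mathcal{A}$ and $\mathcal{B}$ be nice GFG-tNCWs with $L(\mathcal{A})=L(\mathcal{B})$, each minimal (no GFG-tNCW for this language has fewer states) and each $\alpha$-maximal. Then $\mathcal{A}$ and $\mathcal{B}$ are isomorphic.
   Context: A tNCW is $\mathcal{A}=\langle \Sigma,Q,q_0,\delta,\alpha\rangle$ with finite alphabet $\Sigma$, finite state set $Q$, initial state $q_0$, total transition function $\delta:Q\times\Sigma\to 2^Q\setminus\{\emptyset\}$ with transition relation $\Delta=\{\langle q,\sigma,s\rangle: s\in\delta(q,\sigma)\}$, and $\alpha\subseteq\Delta$ ($\alpha$-transitions; the rest are $\bar\alpha$-transitions); $\delta^{\alpha}(q,\sigma)$, $\delta^{\bar\alpha}(q,\sigma)$ denote the $\sigma$-successors of $q$ via $\alpha$- resp. $\bar\alpha$-transitions. A run on $w=\sigma_1\sigma_2\cdots$ is $r_0r_1\cdots$ with $r_0=q_0$, $r_{i+1}\in\delta(r_i,\sigma_{i+1})$, accepting iff it traverses $\alpha$-transitions only finitely often; $L(\mathcal{A})$ is the set of accepted words. $\mathcal{A}^q$ is $\mathcal{A}$ with initial state $q$. $\mathcal{A}$ is GFG if there is $f:\Sigma^*\to Q$ with $f(\epsilon)=q_0$, $\langle f(u),\sigma,f(u\sigma)\rangle\in\Delta$ for all $u,\sigma$, and for every $w\in L(\mathcal{A})$ the run $f(w[1,0]),f(w[1,1]),\dots$ is accepting; a state $q$ is GFG if $\mathcal{A}^q$ is. $q\sim s$ iff $L(\mathcal{A}^q)=L(\mathcal{A}^s)$.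 $\mathcal{A}$ is semantically deterministic if any two $\sigma$-successors of any state are $\sim$-equivalent; safe deterministic if $|\delta^{\bar\alpha}(q,\sigma)|\le1$ always; normal if a path of $\bar\alpha$-transitions from $q$ to $s$ implies one from $s$ to $q$. A GFG-tNCW is nice if all states are reachable and GFG and it is normal, safe deterministic and semantically deterministic. A triple $\langle q,\sigma,s\rangle\in Q\times\Sigma\times Q$ is an allowed transition if there is $s'\in Q$ with $s\sim s'$ and $\langle q,\sigma,s'\rangle\in\Delta$; $\mathcal{A}$ is $\alpha$-maximal if every allowed transition is in $\Delta$. Tnc Ws $\mathcal{A},\mathcal{B}$ with state sets $Q_\mathcal{A},Q_\mathcal{B}$ are isomorphic if there is a bijection $\kappa:Q_\mathcal{A}\to Q_\mathcal{B}$ such that for all $q,q'\in Q_\mathcal{A}$, $\sigma\in\Sigma$: $q'\in\delta^{\alpha}_\mathcal{A}(q,\sigma)$ iff $\kappa(q')\in\delta^{\alpha}_\mathcal{B}(\kappa(q),\sigma)$, and $q'\in\delta^{\bar\alpha}_\mathcal{A}(q,\sigma)$ iff $\kappa(q')\in\delta^{\bar\alpha}_\mathcal{B}(\kappa(q),\sigma)$. *)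

(* Defs.v *)
From mathcomp Require Import all_boot.

Set Implicit Arguments.
Unset Strict Implicit.
Unset Printing Implicit Defensive.

Definition transitions (Sigma Q : finType) (delta : Q -> Sigma -> {set Q}) :
    {set Q * Sigma * Q} :=
  [set t | t.2 \in delta t.1.1 t.1.2].

Record tNCW (Sigma : finType) : Type := TNCW {
  state : finType;
  init : state;
  delta : state -> Sigma -> {set state};
  delta_total : forall q a, delta q a != set0;
  alpha : {set state * Sigma * state};
  alpha_sub : alpha \subset transitions delta
}.

Arguments init {Sigma} t.
Arguments delta {Sigma} t q a.
Arguments alpha {Sigma} t.

Section Automata.
Variable Sigma : finType.
Implicit Types A B C : tNCW Sigma.

Definition Delta A : {set state A * Sigma * state A} := transitions (delta A).

Definition delta_alpha A (q : state A) (a : Sigma) : {set state A} :=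
  [set s in delta A q a | (q, a, s) \in alpha A].

Definition delta_safe A (q : state A) (a : Sigma) : {set state A} :=
  [set s in delta A q a | (q, a, s) \notin alpha A].

(* Letters of infinite words are numbered from 0: [w i] is the letter read
   between positions [i] and [i.+1] of a run. *)
Definition word := nat -> Sigma.

Definition is_run A (w : word) (r : nat -> state A) : Prop :=
  r 0 = init A /\ forall i, r i.+1 \in delta A (r i) (w i).

Definition accepting A (w : word) (r : nat -> state A) : Prop :=
  exists n, forall i, n <= i -> (r i, w i, r i.+1) \notin alpha A.

Definition lang A (w : word) : Prop :=
  exists r, is_run w r /\ @accepting A w r.

Definition start_at A (q : state A) : tNCW Sigma :=
  TNCW q (@delta_total Sigma A) (@alpha_sub Sigma A).

Definition GFG A : Prop :=
  exists f : seq Sigma -> state A,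
    [/\ f [::] = init A,
        forall u a, (f u, a, f (rcons u a)) \in Delta A
      & forall w, lang A w -> accepting w (fun i => f (mkseq w i))].

Definition lang_eq A B : Prop := forall w, lang A w <-> lang B w.

Definition state_equiv A (q s : state A) : Prop :=
  lang_eq (start_at q) (start_at s).

Definition all_reachable A : Prop :=
  forall q, connect [rel p s | [exists a, s \in delta A p a]] (init A) q.

Definition all_GFG A : Prop := forall q : state A, GFG (start_at q).

Definition semantically_deterministic A : Prop :=
  forall (q : state A) a s s',
    s \in delta A q a -> s' \in delta A q a -> state_equiv s s'.

Definition safe_deterministic A : Prop :=
  forall (q : state A) a, #|delta_safe q a| <= 1.

Definition safe_connect A : rel (state A) :=
  connect [rel p s | [exists a, s \in delta_safe p a]].

Definition normal A : Prop :=
  forall q s : state A, safe_connect q s -> safe_connect s q.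

Definition nice A : Prop :=
  [/\ all_reachable A, all_GFG A, normal A, safe_deterministic A
    & semantically_deterministic A].

Definition allowed A (q : state A) (a : Sigma) (s : state A) : Prop :=
  exists s', state_equiv s s' /\ (q, a, s') \in Delta A.

Definition alpha_maximal A : Prop :=
  forall (q : state A) a s, allowed q a s -> (q, a, s) \in Delta A.

Definition minimal A : Prop :=
  forall C, GFG C -> lang_eq C A -> #|state A| <= #|state C|.

Definition isomorphic A B : Prop :=
  exists kappa : state A -> state B,
    bijective kappa /\
    forall (q q' : state A) a,
      (q' \in delta_alpha q a <-> kappa q' \in delta_alpha (kappa q) a) /\
      (q' \in delta_safe q a <-> kappa q' \in delta_safe (kappa q) a).

End Automata.

(* Main.v *)
(** Write q <= s when q and s have the same language and every word that is safe
    (readable without alpha-transitions) from q is safe from s. GFGness of B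
    gives, for each state q of A, a state s of B with q <= s: otherwise, going
    round safe cycles at q that are not safe from the current state of the
    strategy yields an accepted word on which the strategy fails. If S is a set
    of states of A that dominates all states and, up to equivalence, is closed
    under safe transitions, then A restricted to S is still GFG for the same
    language: jump to a dominating state whenever no safe transition exists.
    So minimality of A forces equivalent states to be equal, and comparable
    states to lie in the same safe component. Alternating the domination between
    A and B from q eventually cycles, which gives equivalent states x of A and
    y of B with q <= x; since x leads safely back to q, q too has an equivalent
    state in B. This correspondence is the isomorphism: equivalence transports
    safe transitions, and alpha-maximality makes delta depend on the languages
    of the states only. *)

Require Import Defs.
From mathcomp Require Import all_boot.
From mathcomp Require Import boolp.

Set Implicit Arguments.
Unset Strict Implicit.
Unset Printing Implicit Defensive.

(** * Safe words and the domination preorder between states *)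

Section SafeWords.
Variable Sigma : finType.
Implicit Types (A B : tNCW Sigma) (a : Sigma) (u v : seq Sigma).
Implicit Type w : nat -> Sigma.

(* Junk value: [q] itself when [q] has no safe [a]-transition. *)
Definition safe_next A (q : state A) a : state A :=
  odflt q [pick s in delta_safe q a].

Fixpoint safe_word A (q : state A) u : bool :=
  if u is a :: u' then (delta_safe q a != set0) && safe_word (safe_next q a) u'
  else true.

Definition safe_end A (q : state A) u : state A := foldl (@safe_next A) q u.

Definition suffix w k : nat -> Sigma := fun n => w (k + n).

Lemma safe_nextP A (q : state A) a :
  delta_safe q a != set0 -> safe_next q a \in delta_safe q a.
Proof.
case/set0Pn=> s sP; rewrite /safe_next.
by case: pickP => [t //|/(_ s)]; rewrite sP.
Qed.

Lemma safe_nextE A (q s : state A) a :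
  safe_deterministic A -> s \in delta_safe q a -> safe_next q a = s.
Proof.
move=> detA sP; have ne : delta_safe q a != set0 by apply/set0Pn; exists s.
exact: (card_le1_eqP (detA q a)) sP (safe_nextP ne).
Qed.

Lemma delta_safe_sub A (q s : state A) a : s \in delta_safe q a -> s \in delta _ q a.
Proof. by rewrite inE => /andP[]. Qed.

Lemma safe_word_cat A (q : state A) u v :
  safe_word q (u ++ v) = safe_word q u && safe_word (safe_end q u) v.
Proof. by elim: u q => //= a u IHu q; rewrite IHu andbA. Qed.

Lemma safe_end_cat A (q : state A) u v :
  safe_end q (u ++ v) = safe_end (safe_end q u) v.
Proof. exact: foldl_cat. Qed.

Lemma safe_word_rcons A (q : state A) u a :
  safe_word q (rcons u a) = safe_word q u && (delta_safe (safe_end q u) a != set0).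
Proof. by rewrite -cats1 safe_word_cat /= andbT. Qed.

Lemma safe_end_rcons A (q : state A) u a :
  safe_end q (rcons u a) = safe_next (safe_end q u) a.
Proof. exact: foldl_rcons. Qed.

Lemma safe_connect_end A (q : state A) u :
  safe_word q u -> safe_connect q (safe_end q u).
Proof.
elim/last_ind: u => [_|u a IHu]; first exact: connect0.
rewrite safe_word_rcons safe_end_rcons => /andP[/IHu qu ne].
apply: connect_trans qu (connect1 _) => /=.
by apply/existsP; exists a; apply: safe_nextP.
Qed.

Lemma safe_connect_word A (q s : state A) :
  safe_deterministic A -> safe_connect q s ->
  exists2 u, safe_word q u & safe_end q u = s.
Proof.
move=> detA /connectP[p pP ->]; elim: p q pP => [|t p IHp] q /=.
  by exists [::].
case/andP=> /existsP[a ta] /IHp[u uP uE]; exists (a :: u) => /=.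
  rewrite (safe_nextE detA ta) uP andbT; apply/set0Pn; by exists t.
by rewrite (safe_nextE detA ta).
Qed.

Lemma mkseqSl w k n :
  mkseq (suffix w k) n.+1 = w k :: mkseq (suffix w k.+1) n.
Proof.
rewrite /mkseq /= /suffix addn0 (iotaDl 1 0) -map_comp; congr cons.
by apply: eq_map => i /=; rewrite addnA addn1.
Qed.

Lemma mkseqD w m n : mkseq w (m + n) = mkseq w m ++ mkseq (suffix w m) n.
Proof.
have E : iota m n = map (addn m) (iota 0 n) by rewrite -iotaDl addn0.
by rewrite /mkseq iotaD map_cat add0n E -map_comp.
Qed.

Lemma suffixS w k : (fun n => suffix w k n.+1) = suffix w k.+1.
Proof. by apply/funext => n; rewrite /suffix addSnnS. Qed.

(** By safe determinism, [r] from position [k] on is the run that [safe_next] computes. *)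
Lemma safe_run_word A (r : nat -> state A) w k :
  safe_deterministic A ->
  (forall i, k <= i -> r i.+1 \in delta_safe (r i) (w i)) ->
  forall n, safe_word (r k) (mkseq (suffix w k) n).
Proof.
move=> detA rP n; elim: n k rP => // n IHn k rP.
rewrite mkseqSl /= (safe_nextE detA (rP k (leqnn k))) IHn ?andbT.
  by apply/set0Pn; exists (r k.+1); apply: rP.
by move=> i /ltnW; apply: rP.
Qed.

Lemma lang_safe A (q : state A) w :
  (forall n, safe_word q (mkseq w n)) -> lang (start_at q) w.
Proof.
move=> qw; have st i : safe_end q (mkseq w i.+1)
    \in delta_safe (safe_end q (mkseq w i)) (w i).
  move: (qw i.+1); rewrite mkseqS safe_word_rcons safe_end_rcons.
  by case/andP=> _ /safe_nextP.
exists (fun i => safe_end q (mkseq w i)); split.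
  by split=> // i; apply: delta_safe_sub (st i).
by exists 0 => i _; have:= st i; rewrite inE => /andP[].
Qed.

(** An accepting run from [q] may start with another successor than [q']; semantic determinism
    transfers acceptance to [q']. *)
Lemma lang_succ A (q q' : state A) w :
  semantically_deterministic A -> q' \in delta _ q (w 0) ->
  lang (start_at q) w <-> lang (start_at q') (fun n => w n.+1).
Proof.
move=> semA qq'; split.
  case=> r [[r0 rP] [n acc]]; have r1 : r 1 \in delta _ q (w 0).
    by have := rP 0; rewrite r0.
  apply/(semA q (w 0) (r 1) q' r1 qq'); exists (fun i => r i.+1); split.
    by split=> // i; apply: rP.
  by exists n => i le_ni; apply: acc; apply: leqW.
case=> r [[r0 rP] [n acc]]; exists (fun i => if i is j.+1 then r j else q).
split; first by split=> // -[|i] //=; rewrite r0.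
by exists n.+1 => -[|i] //; apply: acc.
Qed.

Lemma lang_eq_succ A B (q q' : state A) (s s' : state B) a :
  semantically_deterministic A -> semantically_deterministic B ->
  lang_eq (start_at q) (start_at s) ->
  q' \in delta _ q a -> s' \in delta _ s a ->
  lang_eq (start_at q') (start_at s').
Proof.
move=> semA semB eqs qq' ss' w.
pose w' n := if n is m.+1 then w m else a.
have hA := @lang_succ A q q' w' semA qq'; have hB := @lang_succ B s s' w' semB ss'.
by split=> [/hA/eqs/hB|/hB/eqs/hA].
Qed.

Lemma lang_eq_sym A B : lang_eq A B -> lang_eq B A.
Proof. by move=> h w; split=> /h. Qed.

Lemma lang_eq_trans A B (C : tNCW Sigma) :
  lang_eq A B -> lang_eq B C -> lang_eq A C.
Proof. by move=> h k w; split=> [/h/k|/k/h]. Qed.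

(* Finite safe words suffice: in a normal automaton a finite safe run can always
   be prolonged, and by safe determinism the finite runs on the prefixes of an
   infinite word cohere ([lang_safe]). *)
Definition safe_le A B (q : state A) (s : state B) : Prop :=
  lang_eq (start_at q) (start_at s) /\ forall u, safe_word q u -> safe_word s u.

Definition safe_equiv A B (q : state A) (s : state B) : Prop :=
  safe_le q s /\ safe_le s q.

Lemma safe_le_trans A B (C : tNCW Sigma)
    (q : state A) (s : state B) (t : state C) :
  safe_le q s -> safe_le s t -> safe_le q t.
Proof.
case=> qs qs' [st st']; split; first exact: lang_eq_trans st.
by move=> u /qs'/st'.
Qed.

Lemma safe_equiv_sym A B (q : state A) (s : state B) :
  safe_equiv q s -> safe_equiv s q.
Proof. by case. Qed.

Lemma safe_equiv_trans A B (C : tNCW Sigma)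
    (q : state A) (s : state B) (t : state C) :
  safe_equiv q s -> safe_equiv s t -> safe_equiv q t.
Proof. by case=> qs sq [st ts]; split; apply: safe_le_trans; eassumption. Qed.

Lemma safe_le_end A B (q : state A) (s : state B) u :
  semantically_deterministic A -> semantically_deterministic B ->
  safe_le q s -> safe_word q u -> safe_le (safe_end q u) (safe_end s u).
Proof.
move=> semA semB; elim: u q s => //= a u IHu q s qs /andP[ne qu].
have /andP[ne' _] : safe_word s [:: a] by apply: qs.2; rewrite /= ne.
apply: IHu => //; split=> [|v nv].
  apply: lang_eq_succ qs.1 _ _ => //; apply: delta_safe_sub; exact: safe_nextP.
have /andP[] // : safe_word s (a :: v) by apply: qs.2; rewrite /= ne.
Qed.

Lemma safe_equiv_end A B (q : state A) (s : state B) u :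
  semantically_deterministic A -> semantically_deterministic B ->
  safe_equiv q s -> safe_word q u ->
  safe_equiv (safe_end q u) (safe_end s u).
Proof.
move=> semA semB [qs sq] qu; split; apply: safe_le_end => //.
exact: qs.2.
Qed.

End SafeWords.

(** * Restricting an automaton to a dominating set of states *)

Section Restriction.
Variables (Sigma : finType) (A : tNCW Sigma) (S : {set state A}).
Let T : finType := {q : state A | q \in S}.
Variables (above : state A -> T) (next : T -> Sigma -> T).
Hypothesis aboveP : forall q, safe_le q (val (above q)).
(** Both directions of the equivalence matter: one makes words safe in the restriction safe in [A],
    the other lets the strategy keep following a word that is safe in [A]. *)
Hypothesis nextP : forall (p : T) a, delta_safe (val p) a != set0 ->
  safe_equiv (safe_next (val p) a) (val (next p a)).

(** Jumps may go to every equivalent state of [S], because the strategy jumps above the current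
    state of a strategy for [A], which depends on the whole history. *)
Definition restr_delta (p : T) (a : Sigma) : {set T} :=
  if delta_safe (val p) a != set0 then [set next p a]
  else [set p' | [exists s in delta _ (val p) a, `[< state_equiv s (val p') >]]].

Lemma restr_total (p : T) a : restr_delta p a != set0.
Proof.
rewrite /restr_delta; case: ifP => _.
  by apply/set0Pn; exists (next p a); rewrite set11.
have /set0Pn[s sP] := delta_total (val p) a.
apply/set0Pn; exists (above s); rewrite inE; apply/existsP; exists s.
by rewrite sP; apply/asboolP; case: (aboveP s).
Qed.

Definition restr_alpha : {set T * Sigma * T} :=
  [set t in transitions restr_delta | delta_safe (val t.1.1) t.1.2 == set0].

Lemma restr_alpha_sub : restr_alpha \subset transitions restr_delta.
Proof. by apply/subsetP=> t; rewrite inE => /andP[]. Qed.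

Definition restr : tNCW Sigma :=
  TNCW (above (init A)) restr_total restr_alpha_sub.

Lemma restr_non_alpha (p p' : T) a : p' \in restr_delta p a ->
  ((p, a, p') \notin restr_alpha) = (delta_safe (val p) a != set0).
Proof. by move=> pp'; rewrite !inE /= pp'. Qed.

(* Structural recursion peels letters off the front, so [v] is the reversal of
   the word read so far. *)
Fixpoint restr_strategy_rev (f : seq Sigma -> state A) (v : seq Sigma) : T :=
  if v is a :: v' then
    let p := restr_strategy_rev f v' in
    if delta_safe (val p) a != set0 then next p a else above (f (rev v))
  else above (init A).

Definition restr_strategy f u := restr_strategy_rev f (rev u).

Lemma restr_strategy_rcons f u a :
  restr_strategy f (rcons u a) =
  if delta_safe (val (restr_strategy f u)) a != set0
  then next (restr_strategy f u) a else above (f (rcons u a)).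
Proof. by rewrite /restr_strategy rev_rcons /= rev_cons revK. Qed.

Hypothesis semA : semantically_deterministic A.
Hypothesis detA : safe_deterministic A.

Lemma restr_delta_equiv (p p' : T) (q q' : state A) a :
  state_equiv (val p) q -> p' \in restr_delta p a -> q' \in delta _ q a ->
  state_equiv (val p') q'.
Proof.
move=> pq; rewrite /restr_delta; case: ifP => [ne|_].
  rewrite inE => /eqP-> qq'; have [[/lang_eq_sym eqn _] _] := nextP ne.
  apply: lang_eq_trans eqn _; apply: lang_eq_succ pq _ qq' => //.
  exact/delta_safe_sub/safe_nextP.
rewrite inE => /existsP[s /andP[sP /asboolP sp']] qq'.
exact: lang_eq_trans (lang_eq_sym sp') (lang_eq_succ semA semA pq sP qq').
Qed.

Lemma restr_lang_sub w : lang restr w -> lang A w.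
Proof.
case=> r [[r0 rP] [n acc]].
(* Every transition, jump or not, respects residual languages. *)
have step i : lang (start_at (val (r i))) (suffix w i) <-> lang A w.
  elim: i => [|i <-].
    by rewrite r0; have [/(_ w) h _] := aboveP (init A); split=> /h.
  have /set0Pn[s sP] := delta_total (val (r i)) (w i).
  have eqs : state_equiv (val (r i.+1)) s.
    by apply: (restr_delta_equiv _ (rP i) sP).
  have h := @lang_succ _ _ (val (r i)) s (suffix w i) semA.
  rewrite suffixS /suffix addn0 in h; have {}h := h sP.
  by split=> [/eqs/h|/h/eqs].
(* After position [n] there are no more jumps, so the rest of the word is safe in [A] from
   [val (r n)]. *)
apply/(step n)/lang_safe => m.
elim: m n acc {step} => // m IHm n acc; rewrite mkseqSl /=.
have ne : delta_safe (val (r n)) (w n) != set0.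
  by rewrite -(restr_non_alpha (rP n)); apply: acc.
rewrite ne /=; have [_ [_]] := nextP ne; apply.
have := rP n; rewrite /= /restr_delta ne inE => /eqP <-.
by apply: IHm => i /ltnW; apply: acc.
Qed.

(** The strategy [g] takes the safe transition when there is one and otherwise jumps above the state
    of [f], staying equivalent to it throughout. *)
Lemma restr_GFG : GFG A -> GFG restr /\ lang_eq restr A.
Proof.
case=> f [f0 fP facc]; pose g := restr_strategy f.
have g0 : g [::] = above (init A) by [].
have gP u a : g (rcons u a) \in restr_delta (g u) a /\
    state_equiv (val (g (rcons u a))) (f (rcons u a)).
  have inv : state_equiv (val (g u)) (f u).
    elim/last_ind: u => [|u b IHu].
      by rewrite g0 f0; have [/lang_eq_sym] := aboveP (init A).
    have fb : f (rcons u b) \in delta _ (f u) b by have := fP u b; rewrite inE.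
    rewrite /g restr_strategy_rcons -/g; case: ifP => [ne|_].
      apply: (restr_delta_equiv IHu _ fb).
      by rewrite /restr_delta ne set11.
    by have [/lang_eq_sym] := aboveP (f (rcons u b)).
  have fa : f (rcons u a) \in delta _ (f u) a by have := fP u a; rewrite inE.
  have gin : g (rcons u a) \in restr_delta (g u) a.
    rewrite /g restr_strategy_rcons -/g /restr_delta.
    case: ifP => [ne|_]; first by rewrite set11.
    have /set0Pn[s sP] := delta_total (val (g u)) a.
    rewrite inE; apply/existsP; exists s; rewrite sP; apply/asboolP.
    have [le _] := aboveP (f (rcons u a)).
    exact: lang_eq_trans (lang_eq_succ semA semA inv sP fa) le.
  by split=> //; apply: restr_delta_equiv inv gin fa.
have gacc w : lang A w -> accepting (A := restr) w (fun i => g (mkseq w i)).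
  move=> /facc[n acc].
  (* Once the strategy dominates a state from which the rest of the word is
     safe, it never takes an alpha-transition again. *)
  have tail k : (forall m, safe_word (val (g (mkseq w k))) (mkseq (suffix w k) m)) ->
      forall i, k <= i -> delta_safe (val (g (mkseq w i))) (w i) != set0.
    move=> kP i ki; rewrite -(subnKC ki); move: (i - k) => d {ki}.
    elim: d k kP => [|j IHj] k kP.
      by have := kP 1; rewrite mkseqSl addn0 /= andbT.
    rewrite -addSnnS; apply: IHj => m.
    have := kP m.+1; rewrite mkseqSl /= => /andP[ne].
    rewrite mkseqS /g restr_strategy_rcons -/g ne.
    by have [[_ h] _] := nextP ne; apply: h.
  have fsafe k : n <= k -> forall m, safe_word (f (mkseq w k)) (mkseq (suffix w k) m).
    move=> nk; apply: (safe_run_word (r := fun i => f (mkseq w i))) => // i ki.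
    rewrite inE acc ?andbT ?(leq_trans nk) // mkseqS.
    by have := fP (mkseq w i) (w i); rewrite inE.
  have noalpha i : delta_safe (val (g (mkseq w i))) (w i) != set0 ->
      (g (mkseq w i), w i, g (mkseq w i.+1)) \notin alpha restr.
    by move=> ne; rewrite restr_non_alpha // mkseqS; case: (gP (mkseq w i) (w i)).
  (* If [g] is blocked at some [k] after [f] has become safe, its jump lands above a state from
     which the rest is safe, so this jump is the last one. *)
  have [[k [nk k0]]|none] := EM (exists k, n <= k /\
      delta_safe (val (g (mkseq w k))) (w k) = set0).
    exists k.+1 => i ki; apply: noalpha; apply: (tail k.+1 _ i ki) => m.
    rewrite mkseqS /g restr_strategy_rcons -/g k0 eqxx /= -mkseqS.
    by have [_ h] := aboveP (f (mkseq w k.+1)); apply/h/fsafe/leqW.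
  exists n => i ni; apply: noalpha; apply/eqP => i0.
  by apply: none; exists i.
have eqL : lang_eq restr A.
  move=> w; split; first exact: restr_lang_sub.
  move=> wA; exists (fun i => g (mkseq w i)); split; last exact: gacc.
  by split=> // i; rewrite mkseqS; case: (gP (mkseq w i) (w i)).
split=> //; exists g; split=> // [u a|w /restr_lang_sub/gacc //].
by rewrite inE; case: (gP u a).
Qed.

End Restriction.

(** * Consequences of minimality *)

Section Minimality.
Variables (Sigma : finType) (A : tNCW Sigma).
Hypotheses (gfgA : GFG A) (niceA : nice A) (minA : minimal A).

(** The restriction to [S] is a GFG automaton for the same language, so a proper subset [S] would
    contradict minimality. *)
Lemma minimal_cover (S : {set state A}) :
  (forall q : state A, exists2 p, p \in S & safe_le q p) ->
  (forall (p : state A) a, p \in S -> delta_safe p a != set0 ->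
     exists2 p', p' \in S & safe_equiv (safe_next p a) p') ->
  forall q, q \in S.
Proof.
case: niceA => _ _ _ detA semA cover closed q.
have /fin_all_exists[above aboveP] (t : state A) :
    exists p : {q : state A | q \in S}, safe_le t (val p).
  by have [p pS tp] := cover t; exists (Sub p pS).
have /fin_all_exists[next nextP] (pa : {q : state A | q \in S} * Sigma) :
    exists p : {q : state A | q \in S},
      delta_safe (val pa.1) pa.2 != set0 ->
      safe_equiv (safe_next (val pa.1) pa.2) (val p).
  case: pa => p a /=; case: (boolP (delta_safe (val p) a != set0)) => [ne|_].
    by have [p' pS' pp'] := closed _ _ (valP p) ne; exists (Sub p' pS').
  by exists p.
have [gfgC eqC] := restr_GFG (next := fun p a => next (p, a)) aboveP
  (fun p a => nextP (p, a)) semA detA gfgA.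
have := minA gfgC eqC; rewrite card_sig => le_S.
have /eqP -> : S == setT; last by rewrite inE.
by rewrite eqEcard subsetT cardsT.
Qed.

(** If they differed, [q] could be removed, with [s] standing in for it. *)
Lemma safe_equiv_eq (q s : state A) : safe_equiv q s -> q = s.
Proof.
move=> qs; apply/eqP/negP => /negP neq.
have rep (t : state A) : exists2 p, p \in [set~ q] & safe_equiv t p.
  have [->|nt] := eqVneq t q; first by exists s; rewrite // !inE eq_sym.
  by exists t; rewrite ?inE.
suff: q \in [set~ q] by rewrite !inE eqxx.
apply: minimal_cover => [t|p a _ _]; last exact: rep.
by have [p pS [tp _]] := rep t; exists p.
Qed.

(** Otherwise the whole safe component of [q] could be removed: the state reached from [q] by a safe
    word [u] is dominated by the one reached from [s], which by normality lies outside that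
    component. *)
Lemma safe_le_connect (q s : state A) : safe_le q s -> safe_connect q s.
Proof.
case: niceA => _ _ normA detA semA qs; apply/negP => /negP nqs.
suff: q \in [set t | ~~ safe_connect q t] by rewrite inE /safe_connect connect0.
apply: minimal_cover => [t|p a pS ne].
  have [qt|nqt] := boolP (safe_connect q t); last by exists t; rewrite ?inE.
  have [u qu <-] := safe_connect_word detA qt.
  exists (safe_end s u); last exact: safe_le_end.
  rewrite inE; apply: contra nqs => qsu; apply: connect_trans qsu _.
  by apply/normA/safe_connect_end/qs.2.
exists (safe_next p a) => //; move: pS; rewrite !inE; apply: contra => qp.
apply: connect_trans qp _; apply: normA; apply: connect1.
by apply/existsP; exists a; apply: safe_nextP.
Qed.

End Minimality.

(** * Matching the states of two automata for the same language *)

Section Cover.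
Variables (Sigma : finType).
Implicit Types A B : tNCW Sigma.

Lemma reachable_lang_eq A B (q : state A) :
  semantically_deterministic A -> semantically_deterministic B ->
  all_reachable A -> lang_eq A B ->
  exists s : state B, lang_eq (start_at q) (start_at s).
Proof.
move=> semA semB reachA eqAB; have /connectP[p pP ->] := reachA q.
have: exists s : state B, lang_eq (start_at (init A)) (start_at s).
  by exists (init B).
elim: p (init A) pP => //= t p IHp r /andP[/existsP[a ta] pP] [s rs].
apply: IHp pP _; have /set0Pn[s' ss'] := delta_total s a.
exists s'; exact: lang_eq_succ rs ta ss'.
Qed.

(** The limit of a strictly increasing chain of prefixes; letter [i] is read off [H i.+1], which is
    long enough. *)
Lemma mkseq_limit (H : nat -> seq Sigma) (V : nat -> seq Sigma) :
  (forall n, H n.+1 = H n ++ V n) -> (forall n, V n != [::]) ->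
  exists w, forall n, n <= size (H n) /\ mkseq w (size (H n)) = H n.
Proof.
move=> HS Vn; have sz n : n <= size (H n).
  elim: n => // n IHn; rewrite HS size_cat -addn1 leq_add //.
  by rewrite lt0n size_eq0.
have [a0 _] : exists a : Sigma, True by case: (V 0) (Vn 0) => // a; exists a.
have pre i n : i <= n -> exists t, H n = H i ++ t.
  move=> le_in; rewrite -(subnKC le_in); elim: (n - i) => [|k [t IHk]].
    by exists [::]; rewrite addn0 cats0.
  by exists (t ++ V (i + k)); rewrite addnS HS IHk catA.
exists (fun i => nth a0 (H i.+1) i) => n; split=> //.
apply: (@eq_from_nth _ a0) => [|i]; rewrite size_mkseq // => lt_i.
rewrite nth_mkseq //; case: (leqP n i.+1) => [/pre|/ltnW/pre] [t ->].
  by rewrite nth_cat lt_i.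
by rewrite nth_cat sz.
Qed.

Lemma safe_le_exists A B (q : state A) :
  nice A -> nice B -> lang_eq A B -> exists s : state B, safe_le q s.
Proof.
case=> reachA _ normA detA semA [_ gfgB _ detB semB] eqAB.
have [s0 qs0] := reachable_lang_eq q semA semB reachA eqAB.
apply: contrapT => none.
(* [V s] is a safe loop at [q] that defeats [s]: a word safe from [q] but not from [s], then a safe
   way back given by normality. *)
have /fin_all_exists[V VP] (s : state B) :
    exists v, lang_eq (start_at q) (start_at s) ->
      [/\ safe_word q v, safe_end q v = q & ~~ safe_word s v].
  have [qs|nqs] := EM (lang_eq (start_at q) (start_at s)); last by exists [::].
  have [v [qv nsv]] : exists v, safe_word q v /\ ~~ safe_word s v.
    apply: contrapT => nv; apply: none; exists s; split=> // u qu.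
    by apply/negP => /negP nsu; apply: nv; exists u.
  have [v' v'P v'E] := safe_connect_word detA (normA _ _ (safe_connect_end qv)).
  exists (v ++ v') => _.
  by rewrite !safe_word_cat safe_end_cat qv v'P v'E (negPf nsv).
have [f [f0 fS facc]] : exists f : seq Sigma -> state B,
    [/\ f [::] = s0, forall u a, f (rcons u a) \in delta B (f u) a
      & forall w, lang (start_at s0) w -> accepting w (fun i => f (mkseq w i))].
  have [f [f0 fP facc]] := gfgB s0; exists f; split=> // u a.
  by have := fP u a; rewrite inE.
(* Each new loop is chosen against the state that the strategy has just reached. *)
pose H := fix H n := if n is m.+1 then H m ++ V (f (H m)) else [::].
have fequiv u : safe_word q u -> lang_eq (start_at (safe_end q u)) (start_at (f u)).
  elim/last_ind: u => [|u a IHu]; first by rewrite f0.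
  rewrite safe_word_rcons safe_end_rcons => /andP[/IHu eqs ne].
  by apply: lang_eq_succ eqs _ (fS u a) => //; apply/delta_safe_sub/safe_nextP.
have HP n : safe_word q (H n) /\ safe_end q (H n) = q.
  elim: n => //= n [qH eH]; have := fequiv _ qH; rewrite eH => /VP[v1 v2 _].
  by rewrite safe_word_cat safe_end_cat qH eH.
have VH n : [/\ safe_word q (V (f (H n))), safe_end q (V (f (H n))) = q
               & ~~ safe_word (f (H n)) (V (f (H n)))].
  by have [qH eH] := HP n; have := fequiv _ qH; rewrite eH => /VP.
have [w wP] := @mkseq_limit H (fun n => V (f (H n))) (fun=> erefl)
  (fun n => ltac:(by case: (VH n) => _ _; apply: contraNneq => ->)).
have wq : lang (start_at q) w.
  apply: lang_safe => n; have [le_n eH] := wP n; have [qH _] := HP n.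
  move: qH; rewrite -eH -(subnKC le_n) mkseqD safe_word_cat.
  by case/andP.
have [n acc] := facc w ((qs0 w).1 wq).
(* Since [n <= size (H n)], the strategy is already safe when it starts reading [V (f (H n))], which
   is not safe from there. *)
have [le_n eH] := wP n; have [_ eH'] := wP n.+1; have [_ _ /negP[]] := VH n.
have := @safe_run_word _ B (fun i => f (mkseq w i)) w (size (H n)) detB.
rewrite eH => h; have {}h := h (fun i ki => ltac:(
  by rewrite inE mkseqS fS -mkseqS; apply: acc; apply: leq_trans ki)).
suff <- : mkseq (suffix w (size (H n))) (size (V (f (H n)))) = V (f (H n)) by [].
move/eqP: eH'; rewrite /= size_cat mkseqD eH eqseq_cat //.
by case/andP=> _ /eqP.
Qed.

Lemma safe_equiv_exists A B (q : state A) :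
  GFG A -> nice A -> minimal A -> nice B -> lang_eq A B ->
  exists s : state B, safe_equiv q s.
Proof.
move=> gfgA niceA minA niceB eqAB.
have [_ _ normA detA semA] := niceA; have [_ _ _ _ semB] := niceB.
have /fin_all_exists[up upP] (t : state A) : exists s : state B, safe_le t s.
  exact: safe_le_exists.
have /fin_all_exists[down downP] (s : state B) : exists t : state A, safe_le s t.
  exact: safe_le_exists (lang_eq_sym eqAB).
pose g t := down (up t).
have le_g t : safe_le t (g t) by apply: safe_le_trans (upP t) (downP _).
have le_iter n t : safe_le t (iter n g t).
  by elim: n => //= n IHn; apply: safe_le_trans IHn (le_g _).
(* The iterates of [g] enter a cycle at [x]; going round it gives [up x] below [g x] below [x]. *)
have /trajectP[i lt_i eq_i] := looping_order g q.
set x := iter i g q; have x_up : safe_equiv x (up x).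
  split=> //; apply: safe_le_trans (downP _) _; rewrite -/(g x).
  have {2}-> : x = iter (order g q - i.+1) g (g x).
    by rewrite -[g x]/(iter i.+1 g q) -iterD subnK.
  exact: le_iter.
(* A safe word leading from [x] back to [q] leads from [up x] to the desired match of [q]. *)
have /normA xq : safe_connect q x by apply: safe_le_connect => //; apply: le_iter.
have [u xu <-] := safe_connect_word detA xq.
by exists (safe_end (up x) u); apply: safe_equiv_end.
Qed.

(** Any [a]-successor of [s] has the language of [q'], hence of [s'], so the transition to [s'] is
    allowed. *)
Lemma safe_equiv_delta A B (q q' : state A) (s s' : state B) a :
  semantically_deterministic A -> semantically_deterministic B ->
  alpha_maximal B -> safe_equiv q s -> safe_equiv q' s' ->
  q' \in delta _ q a -> s' \in delta _ s a.
Proof.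
move=> semA semB maxB [[qs _] _] [[qs' _] _] qq'.
have /set0Pn[t st] := delta_total s a.
suff: (s, a, s') \in Delta B by rewrite inE.
apply: maxB; exists t; split; last by rewrite inE.
apply: lang_eq_trans (lang_eq_sym qs') _.
exact: lang_eq_succ qs qq' st.
Qed.

Lemma safe_equiv_delta_safe A B (q q' : state A) (s s' : state B) a :
  GFG B -> nice B -> minimal B -> nice A ->
  safe_equiv q s -> safe_equiv q' s' ->
  q' \in delta_safe q a -> s' \in delta_safe s a.
Proof.
move=> gfgB niceB minB [_ _ _ detA semA] qs qs' qq'.
have [_ _ _ detB semB] := niceB.
have qa : safe_word q [:: a] by rewrite /= andbT; apply/set0Pn; exists q'.
have := safe_equiv_end semA semB qs qa; rewrite /= (safe_nextE detA qq') => q's.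
have /= /andP[ne _] := qs.1.2 _ qa.
(* Both states are equivalent to [q'], and minimality of [B] identifies them. *)
have -> : s' = safe_next s a; last exact: safe_nextP.
apply: safe_equiv_eq => //.
exact: safe_equiv_trans (safe_equiv_sym qs') q's.
Qed.

End Cover.

(** * The isomorphism *)

Lemma delta_alphaE (Sigma : finType) (A : tNCW Sigma) (q s : state A) a :
  (s \in delta_alpha q a) = (s \in delta _ q a) && (s \notin delta_safe q a).
Proof. by rewrite !inE; case: (s \in delta _ q a) => //=; rewrite negbK. Qed.

Theorem theorem4p4 (Sigma : finType) (A B : tNCW Sigma)
    (gfgA : GFG A) (gfgB : GFG B) (niceA : nice A) (niceB : nice B)
    (eqAB : lang_eq A B)
    (minA : minimal A) (minB : minimal B)
    (maxA : alpha_maximal A) (maxB : alpha_maximal B) :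
  isomorphic A B.
Proof.
have [_ _ _ _ semA] := niceA; have [_ _ _ _ semB] := niceB.
have /fin_all_exists[kappa kP] (q : state A) : exists s : state B, safe_equiv q s.
  exact: safe_equiv_exists.
have /fin_all_exists[kinv vP] (s : state B) : exists q : state A, safe_equiv s q.
  exact: safe_equiv_exists (lang_eq_sym eqAB).
(* The converse is the same lemma with the automata exchanged, so it rests on [maxA]. *)
have delE q q' a : (q' \in delta _ q a) = (kappa q' \in delta _ (kappa q) a).
  by apply/idP/idP; apply: safe_equiv_delta => //; apply: safe_equiv_sym.
have safeE q q' a : (q' \in delta_safe q a) = (kappa q' \in delta_safe (kappa q) a).
  by apply/idP/idP; apply: safe_equiv_delta_safe => //; apply: safe_equiv_sym.
exists kappa; split; last by move=> q q' a; rewrite !delta_alphaE delE safeE.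
exists kinv => [q|s]; apply: esym; apply: safe_equiv_eq => //.
  exact: safe_equiv_trans (kP q) (vP _).
exact: safe_equiv_trans (vP s) (kP _).
Qed.
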